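(* Let $A\in\mathbb C^{n\times n}$, $G\in\mathbb C^{n\times g}$, $S\in\mathbb C^{g\times g}$, and consider the low-rank Lyapunov ADI iterates $X_k\in\mathbb C^{n\times n}$, $k\in\mathbb N$, for $GSG^{\mathsf H}+AX+XA^{\mathsf H}=0$, started from an initial value $X_0=Z_0Y_0Z_0^{\mathsf H}$ with $Z_0\in\mathbb C^{n\times z}$ and Hermitian $Y_0\in\mathbb C^{z\times z}$, with residuals $r^k:=GSG^{\mathsf H}+AX_k+X_kA^{\mathsf H}$. Then there exists a factorization $r^k=R_kTR_k^{\mathsf H}$ of the residuals that is consistent with the initial residual $r^0=R_0TR_0^{\mathsf H}$, i.e. whose inner factor $T$ does not depend on the iteration $k\in\mathbb N$. More explicitly: whenever $r^0=R_0TR_0^{\mathsf H}$ with $R_0\in\mathbb C^{n\times m}$ and $T\in\mathbb C^{m\times m}$, there exist $R_k\in\mathbb C^{n\times m}$ for $k\geq 1$ such that $r^k=R_kTR_k^{\mathsf H}$ for all $k\in\mathbb N$.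
   Context: $(\cdot)^{\mathsf H}$ denotes the Hermitian (conjugate) transpose. It is assumed that $\lambda_i+\overline{\lambda_j}\neq0$ for any two eigenvalues $\lambda_i,\lambda_j$ of $A$, so the Lyapunov equation has a unique solution. The Lyapunov ADI with parameters $\alpha_k\in\mathbb C$ (and second parameter $\beta_k:=\overline{\alpha_k}$), where $\operatorname{Re}\alpha_k\neq0$ and $-\alpha_k$ is not an eigenvalue of $A$, is the splitting iteration $M_k(X_{k+1})=N_k(X_k)-GSG^{\mathsf H}$, with $$M_k(U)=\frac{1}{2\operatorname{Re}\alpha_k}(A+\alpha_kI)\,U\,(A+\alpha_kI)^{\mathsf H},\qquad N_k(U)=\frac{1}{2\operatorname{Re}\alpha_k}(A-\overline{\alpha_k}I)\,U\,(A-\overline{\alpha_k}I)^{\mathsf H},$$ which satisfies $M_k(U)-N_k(U)=AU+UA^{\mathsf H}$. One possible factorization of $r^0$ has outer factor $[\,G\;\;Z_0\;\;AZ_0\,]$ and inner factor $\begin{bmatrix}S&0&0\\0&0&Y_0\\0&Y_0&0\end{bmatrix}$. *)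

(* Defs.v *)
From mathcomp Require Export all_boot all_order all_algebra.
From mathcomp Require Export sesquilinear spectral.
From mathcomp Require Export complex reals.

Set Implicit Arguments.
Unset Strict Implicit.
Unset Printing Implicit Defensive.

Export Order.TTheory GRing.Theory Num.Theory.

Global Open Scope ring_scope.
Global Open Scope sesquilinear_scope.

Section LyapunovADI.

Variables (C : numClosedFieldType) (n g : nat).
Implicit Types (A U X : 'M[C]_n) (G : 'M[C]_(n, g)) (S : 'M[C]_g) (a : C).

Definition adi_M A a U : 'M[C]_n :=
  (2 * 'Re a)^-1 *: ((A + a%:M) *m U *m (A + a%:M)^t*).

Definition adi_N A a U : 'M[C]_n :=
  (2 * 'Re a)^-1 *: ((A - (a^*)%:M) *m U *m (A - (a^*)%:M)^t*).

(* [Re a <> 0] makes the prefactors of [adi_M] and [adi_N] meaningful, and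
   the eigenvalue condition makes [adi_M A a] invertible. *)
Definition admissible_shift A a : Prop :=
  'Re a != 0 /\ ~~ eigenvalue A (- a).

Definition is_lyapunov_adi A G S (alpha : nat -> C) (X : nat -> 'M[C]_n) : Prop :=
  forall k : nat,
    adi_M A (alpha k) (X k.+1) = adi_N A (alpha k) (X k) - G *m S *m G^t*.

Definition lyap_residual A G S X : 'M[C]_n :=
  G *m S *m G^t* + A *m X + X *m A^t*.

End LyapunovADI.

(* Main.v *)
Require Import Defs.
From mathcomp Require Import ring.
Set Implicit Arguments.
Unset Strict Implicit.
Unset Printing Implicit Defensive.

(** With [P := A + a I] and [Q := A - a^* I], the splitting [M - N] is the
Lyapunov operator, so the ADI step gives both [r^k = M (X_k - X_{k+1})] and
[r^{k+1} = N (X_k - X_{k+1})].  Hence [r^{k+1} = W r^k W^H] for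
[W := Q P^-1]: the congruence acts on the outer factor alone. *)

Lemma trmxC_mul (C : numClosedFieldType) (m n p : nat)
    (A : 'M[C]_(m, n)) (B : 'M[C]_(n, p)) :
  (A *m B)^t* = B^t* *m A^t*.
Proof. by rewrite trmx_mul map_mxM. Qed.

Section ADIResidual.

Variables (C : numClosedFieldType) (n g : nat).
Implicit Types (A U V X Y : 'M[C]_n) (G : 'M[C]_(n, g)) (S : 'M[C]_g) (a : C).

Lemma trmxC_add_scalar A a : (A + a%:M)^t* = A^t* + (a^*)%:M.
Proof. by rewrite linearD /= map_mxD tr_scalar_mx map_scalar_mx. Qed.

(** The eigenspace at [- a] is the kernel of [A + a%:M], and a square matrix with trivial kernel is
    invertible. *)
Lemma unitmx_add_shift A a : ~~ eigenvalue A (- a) -> A + a%:M \in unitmx.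
Proof.
by rewrite /eigenvalue /eigenspace negbK kermx_eq0 row_free_unit raddfN opprK.
Qed.

Lemma adi_M_subN A a U : 'Re a != 0 ->
  adi_M A a U - adi_N A a U = A *m U + U *m A^t*.
Proof.
move=> a0; rewrite /adi_M /adi_N -scalerBr.
have Ha : 2 * 'Re a = a + a^* by rewrite ReE mulrC divfK // pnatr_eq0.
have Ha0 : 2 * 'Re a != 0 by rewrite mulf_neq0 // pnatr_eq0.
have QH : (A - (a^*)%:M)^t* = A^t* - a%:M.
  rewrite -(raddfN (@scalar_mx _ _)) trmxC_add_scalar rmorphN /= conjCK.
  by rewrite raddfN.
apply: (canLR (scalerK Ha0)); rewrite {}Ha {}QH trmxC_add_scalar.
rewrite !(mulmxDl, mulmxDr, mulNmx, mulmxN) !mul_mx_scalar !mul_scalar_mx.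
(* Once the matrix products are opaque, the claim is entrywise a commutative ring identity. *)
rewrite -!scalemxAl; move: (A *m U *m A^t*) (A *m U) (U *m A^t*) => AUA AU UA.
by apply/matrixP => i j; rewrite !mxE; ring.
Qed.

Lemma adi_M_sub A a U V : adi_M A a (U - V) = adi_M A a U - adi_M A a V.
Proof. by rewrite /adi_M mulmxBr mulmxBl scalerBr. Qed.

Lemma adi_N_sub A a U V : adi_N A a (U - V) = adi_N A a U - adi_N A a V.
Proof. by rewrite /adi_N mulmxBr mulmxBl scalerBr. Qed.

(** Both operators carry the same prefactor, and [W] is chosen so that [W *m P = Q]; taking
    adjoints, [P^t* *m W^t* = Q^t*]. *)
Lemma adi_N_congruence A a U : ~~ eigenvalue A (- a) ->
  let W := (A - (a^*)%:M) *m invmx (A + a%:M) in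
  adi_N A a U = W *m adi_M A a U *m W^t*.
Proof.
move=> /unitmx_add_shift uP /=; rewrite /adi_N /adi_M.
set P := A + _ in uP *; set Q := A - _.
have WP : Q *m invmx P *m P = Q by rewrite mulmxKV.
rewrite -scalemxAr -scalemxAl !mulmxA WP.
by rewrite -[X in _ = _ *: X]mulmxA -trmxC_mul WP.
Qed.

Lemma lyap_residual_adi_step A G S a X Y : admissible_shift A a ->
    adi_M A a Y = adi_N A a X - G *m S *m G^t* ->
  let W := (A - (a^*)%:M) *m invmx (A + a%:M) in
  lyap_residual A G S Y = W *m lyap_residual A G S X *m W^t*.
Proof.
move=> [a0 aA] step W.
(* The constant term is traded for [N X - M Y]. With the Lyapunov part written as [M - N], [N X]
   then cancels in the residual of [X] and [M Y] in that of [Y]. *)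
have GSG : G *m S *m G^t* = adi_N A a X - adi_M A a Y.
  by rewrite step opprB addrC subrK.
have resX : lyap_residual A G S X = adi_M A a (X - Y).
  rewrite /lyap_residual -addrA -(adi_M_subN _ _ a0) GSG adi_M_sub.
  by rewrite addrC addrA subrK.
have resY : lyap_residual A G S Y = adi_N A a (X - Y).
  rewrite /lyap_residual -addrA -(adi_M_subN _ _ a0) GSG adi_N_sub.
  by rewrite addrA subrK.
by rewrite resX resY; exact: adi_N_congruence.
Qed.

Lemma lyap_residual_factor A G S (alpha : nat -> C) (X : nat -> 'M[C]_n)
    (m : nat) (R0 : 'M[C]_(n, m)) (T : 'M[C]_m) :
    (forall k, admissible_shift A (alpha k)) -> is_lyapunov_adi A G S alpha X ->
    lyap_residual A G S (X 0%N) = R0 *m T *m R0^t* ->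
  exists Rf : nat -> 'M[C]_(n, m), Rf 0%N = R0 /\
    forall k, lyap_residual A G S (X k) = Rf k *m T *m (Rf k)^t*.
Proof.
move=> adm adi r0.
pose W k := (A - ((alpha k)^*)%:M) *m invmx (A + (alpha k)%:M).
(* The outer factor accumulates the congruences, [Rf k = W_(k-1) ... W_0 R0], so [T] is never
   touched. *)
exists (nat_rect _ R0 (fun k Rk => W k *m Rk)); split=> //.
elim=> [//|k IHk] /=.
rewrite (lyap_residual_adi_step (adm k) (adi k)) IHk.
by rewrite [in RHS]trmxC_mul !mulmxA.
Qed.

End ADIResidual.

Theorem lemma4p2 (R : realType) (n g z : nat)
    (A : 'M[R[i]]_n) (G : 'M[R[i]]_(n, g)) (S : 'M[R[i]]_g)
    (Z0 : 'M[R[i]]_(n, z)) (Y0 : 'M[R[i]]_z)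
    (alpha : nat -> R[i]) (X : nat -> 'M[R[i]]_n)
    (hA : forall l1 l2 : R[i],
       eigenvalue A l1 -> eigenvalue A l2 -> l1 + l2^* != 0)
    (hY0 : Y0 \is hermsymmx)
    (halpha : forall k : nat, admissible_shift A (alpha k))
    (hX0 : X 0%N = Z0 *m Y0 *m Z0^t*)
    (hX : is_lyapunov_adi A G S alpha X) :
  (exists (m : nat) (T : 'M[R[i]]_m) (Rf : nat -> 'M[R[i]]_(n, m)),
     forall k : nat, lyap_residual A G S (X k) = Rf k *m T *m (Rf k)^t*)
  /\
  (forall (m : nat) (R0 : 'M[R[i]]_(n, m)) (T : 'M[R[i]]_m),
     lyap_residual A G S (X 0%N) = R0 *m T *m R0^t* ->
     exists Rf : nat -> 'M[R[i]]_(n, m),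
       Rf 0%N = R0 /\
       forall k : nat, lyap_residual A G S (X k) = Rf k *m T *m (Rf k)^t*).
Proof.
pose factor := @lyap_residual_factor _ n g A G S alpha X.
split=> [|m R0 T r0]; last exact: (factor m R0 T halpha hX r0).
pose r := lyap_residual A G S (X 0%N).
(* Any factorization of the initial residual can start the recursion; the trivial one takes [r]
   itself as inner factor. *)
have r0 : r = 1%:M *m r *m (1%:M)^t* by rewrite trmx1 map_mx1 mul1mx mulmx1.
have [Rf [_ resE]] := factor n 1%:M r halpha hX r0.
by exists n, r, Rf.
Qed.
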